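(* Let $U=(u_1,\dots,u_m)\in\mathcal{U}(n,m)$ and $\gamma\in\mathbb{R}^m_{>0}$ with $\sum_{i=1}^m\gamma_i=1$. Then the finite discrete Borel measure $\mu(U,\gamma)=\sum_{i=1}^m\gamma_i\,\delta_{u_i}$ on $\mathbb{S}^{n-1}$ satisfies the subspace concentration condition if and only if $\gamma\in\operatorname{relint}P_{\mathrm{scc}}(U)$.
   Context: $\mathcal{U}(n,m)$ denotes the set of all matrices $U=(u_1,\dots,u_m)$ whose columns $u_i\in\mathbb{S}^{n-1}\subset\mathbb{R}^n$ are pairwise distinct unit vectors with $\operatorname{pos}U=\mathbb{R}^n$ (every vector of $\mathbb{R}^n$ is a non-negative linear combination of the $u_i$). $U$ is also identified with the set $\{u_1,\dots,u_m\}$. $\delta_u$ is the Dirac measure at $u$. The measure $\mu=\mu(U,\gamma)$, $\gamma>0$, satisfies the subspace concentration condition if: (1) for every proper linear subspace $L\subset\mathbb{R}^n$, $\mu(L)=\sum_{u_i\in L}\gamma_i\le\frac{\dim L}{n}\,\mu(\mathbb{S}^{n-1})$; and (2) equality holds in (1) for $L$ if and only if there exists a linear subspace $\overline{L}$ complementary to $L$ such that $\{u_1,\dots,u_m\}\subset L\cup\overline{L}$. Subspace concentration polytope: let $\mathcal{B}(U)$ be the set of all subsets of $\{u_1,\dots,u_m\}$ forming a basis of $\mathbb{R}^n$, and for $B\in\mathcal{B}(U)$ let $\chi_U(B)\in\{0,1\}^m$ be its characteristic vector ($i$-th entry $1$ iff $u_i\in B$). Then $P_{\mathrm{scc}}(U)=\frac1n\operatorname{conv}\{\chi_U(B):B\in\mathcal{B}(U)\}\subset\mathbb{R}^m$.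 $\operatorname{relint}$ denotes the interior relative to the affine hull. *)

(* Defs.v *)
From HB Require Import structures.
From mathcomp Require Import all_boot all_order all_algebra.
From mathcomp Require Import all_classical all_reals all_analysis.

Set Implicit Arguments.
Unset Strict Implicit.
Unset Printing Implicit Defensive.

Import Order.TTheory GRing.Theory Num.Theory.
Import numFieldNormedType.Exports.

Local Open Scope classical_set_scope.
Local Open Scope ring_scope.

(* MathComp-Analysis equips matrices with the sup norm, so the Euclidean norm
   is defined explicitly. *)
Definition enorm (R : realType) (n : nat) (x : 'cV[R]_n) : R :=
  Num.sqrt (\sum_(i < n) x i 0 ^+ 2).

(* The unit sphere S^n of R^(n+1), with its subspace topology. A measurableType
   must be inhabited, which is why the ambient dimension is a successor. *)
Definition sphere_set (R : realType) (n : nat) : set 'cV[R]_n.+1 :=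
  [set x | enorm x = 1].

Definition sphere (R : realType) (n : nat) : Type := set_type (@sphere_set R n).

HB.instance Definition _ (R : realType) (n : nat) :=
  Topological.copy (sphere R n) (set_type (@sphere_set R n)).

Fact sphere_point_subproof (R : realType) (n : nat) :
  delta_mx 0 0 \in @sphere_set R n.
Proof.
apply/mem_set; rewrite /sphere_set /= /enorm big_ord_recl big1 => [|i _].
  by rewrite mxE !eqxx expr1n addr0 sqrtr1.
by rewrite mxE expr0n.
Qed.

HB.instance Definition _ (R : realType) (n : nat) :=
  isPointed.Build (sphere R n)
    (exist _ (delta_mx 0 0) (@sphere_point_subproof R n)).

Definition borel_sphere (R : realType) (n : nat) :=
  g_sigma_algebraType (@open (sphere R n)).

Section DiscreteMeasure.
Local Open Scope ereal_scope.
Context d (T : measurableType d) (R : realType) (m : nat).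
Variables (u : 'I_m -> T) (g : 'I_m -> {nonneg R}).

Definition discrete_measure (A : set T) : \bar R :=
  \sum_(i < m) (g i)%:num%:E * \d_(u i) A.

Let discrete_measure0 : discrete_measure set0 = 0.
Proof. by rewrite /discrete_measure big1// => i _; rewrite dirac0 mule0. Qed.

Let discrete_measure_ge0 A : 0 <= discrete_measure A.
Proof. by apply: sume_ge0 => i _; rewrite mule_ge0. Qed.

Let discrete_measure_sigma_additive : semi_sigma_additive discrete_measure.
Proof.
move=> F mF tF mUF; rewrite [X in _ --> X](_ : _ =
    lim ((fun n => \sum_(0 <= i < n) discrete_measure (F i)) @ \oo)).
  by apply: is_cvg_ereal_nneg_natsum => k _; exact: discrete_measure_ge0.
rewrite nneseries_sum//; last by move=> *; exact: mule_ge0.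
apply: eq_bigr => /= i _.
exact: (@measure_semi_bigcup _ _ _ (mscale (g i) \d_(u i))).
Qed.

HB.instance Definition _ := isMeasure.Build _ _ _ discrete_measure
  discrete_measure0 discrete_measure_ge0 discrete_measure_sigma_additive.

Let discrete_measure_fin : fin_num_fun discrete_measure.
Proof.
move=> A mA; rewrite /discrete_measure.
by under eq_bigr do rewrite diracE -EFinM; rewrite sumEFin.
Qed.

HB.instance Definition _ :=
  Measure_isFinite.Build _ _ _ discrete_measure discrete_measure_fin.

End DiscreteMeasure.

Definition pos_hull (R : realType) (n m : nat) (U : 'M[R]_(n, m)) :
    set 'cV[R]_n :=
  [set x | exists2 c : 'I_m -> R,
    forall i, 0 <= c i & x = \sum_(i < m) c i *: col i U].

Definition Ucal (R : realType) (n m : nat) (U : 'M[R]_(n, m)) : Prop :=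
  [/\ forall i, enorm (col i U) = 1,
      injective (fun i => col i U) &
      pos_hull U = setT].

Definition sphere_col (R : realType) (n m : nat) (U : 'M[R]_(n.+1, m))
    (hU : Ucal U) (i : 'I_m) : borel_sphere R n :=
  exist _ (col i U) (mem_set (let: And3 h _ _ := hU in h i)).

Definition mu (R : realType) (n m : nat) (U : 'M[R]_(n.+1, m)) (hU : Ucal U)
    (gamma : 'cV[R]_m) (gamma_gt0 : forall i, 0 < gamma i 0) :
    {finite_measure set borel_sphere R n -> \bar R} :=
  discrete_measure (sphere_col hU) (fun i => NngNum (ltW (gamma_gt0 i))).

Definition sphere_sub (R : realType) (n : nat) (L : {vspace 'cV[R]_n.+1}) :
    set (borel_sphere R n) :=
  [set x | set_val x \in L].

Definition complementary (K : fieldType) (V : vectType K)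
    (L L' : {vspace V}) : Prop :=
  (L :&: L')%VS = 0%VS /\ (L + L')%VS = fullv.

Definition subspace_concentration (R : realType) (n m : nat)
    (U : 'M[R]_(n.+1, m))
    (nu : {finite_measure set borel_sphere R n -> \bar R}) : Prop :=
  (forall L : {vspace 'cV[R]_n.+1}, L != fullv ->
     (nu (sphere_sub L) <= ((\dim L)%:R / n.+1%:R)%:E * nu setT)%E) /\
  (forall L : {vspace 'cV[R]_n.+1}, L != fullv ->
     (nu (sphere_sub L) = ((\dim L)%:R / n.+1%:R)%:E * nu setT)%E <->
     exists2 L' : {vspace 'cV[R]_n.+1}, complementary L L' &
       forall i, col i U \in L \/ col i U \in L').

Definition convex_hull (R : realType) (V : lmodType R) (A : set V) : set V :=
  [set x | exists (k : nat) (w : 'I_k -> R) (p : 'I_k -> V),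
    [/\ forall i, 0 <= w i, \sum_(i < k) w i = 1, forall i, A (p i) &
        x = \sum_(i < k) w i *: p i]].

Definition affine_hull (R : realType) (V : lmodType R) (A : set V) : set V :=
  [set x | exists (k : nat) (w : 'I_k -> R) (p : 'I_k -> V),
    [/\ \sum_(i < k) w i = 1, forall i, A (p i) &
        x = \sum_(i < k) w i *: p i]].

(* Points outside the affine hull are isolated in the topology of [subspace],
   but this is harmless here since A is contained in its affine hull. *)
Definition relint (R : realType) (m : nat) (A : set 'cV[R]_m) : set 'cV[R]_m :=
  @interior (subspace (affine_hull A)) A.

(* As the columns of U in Ucal are pairwise distinct, a set of columns is
   represented by the set of its indices. *)
Definition bases (R : realType) (n m : nat) (U : 'M[R]_(n, m)) :
    set {set 'I_m} :=
  [set B | basis_of fullv [seq col i U | i in B]].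

Definition chi (R : realType) (m : nat) (B : {set 'I_m}) : 'cV[R]_m :=
  \col_(i < m) (i \in B)%:R.

Definition Pscc (R : realType) (n m : nat) (U : 'M[R]_(n, m)) : set 'cV[R]_m :=
  [set n%:R^-1 *: x | x in convex_hull [set chi R B | B in bases U]].

(* Main.v *)
Require Import Defs.
From mathcomp Require Import all_boot all_order all_algebra.
From mathcomp Require Import all_classical all_reals all_analysis.
From mathcomp Require Import fintype finset.

Import Order.TTheory GRing.Theory Num.Theory.
Import numFieldNormedType.Exports.

Set Implicit Arguments.
Unset Strict Implicit.
Unset Printing Implicit Defensive.

Local Open Scope ring_scope.

(* A relative interior point of a polytope is the same as a convex combination
   of its vertices with all coefficients positive. If such a combination does
   not exist for gamma, Farkas' lemma gives weights c with c.p <= c.gamma for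
   all vertices p of P_scc(U), not always with equality. Let B be a basis of
   maximal weight. By the exchange property every level set {c >= t} is spanned
   by its elements in B, so the concentration inequalities and summation over
   the level sets give c.gamma <= c.chi(B)/n. Hence all of them are tight at the
   level sets, which are then traces of subspaces splitting U; every basis meets
   such a trace in the same number of vectors, so c is constant on P_scc(U).
   Conversely, a linear functional that attains its maximum over P_scc(U) at a
   relative interior point is constant on P_scc(U); for the functional
   x |-> x(L) this means that all bases meet L in dim L vectors, and then the
   vectors outside L span a complement of L. *)

(** * Farkas' lemma and layer-cake sums *)

(** Induction on the generators. When the functional [y] found for the tail is negative on the new
    generator, the problem is projected along that generator, and each alternative lifts back. *)
Lemma farkas (F : realFieldType) (n : nat) (J : eqType) (a : J -> 'cV[F]_n)
    (b : 'cV[F]_n) (r : seq J) :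
  uniq r ->
  (exists2 w : J -> F, forall j, 0 <= w j & b = \sum_(j <- r) w j *: a j) \/
  (exists2 y : 'rV[F]_n, {in r, forall j, 0 <= (y *m a j) 0 0} &
    (y *m b) 0 0 < 0).
Proof.
elim: r a b => [|k r IH] a b /=.
  move=> _; have [->|b0] := eqVneq b 0.
    by left; exists (fun=> 0) => //; rewrite big_nil.
  right; exists (- b^T) => //; rewrite mulNmx mxE oppr_lt0 mxE.
  have sq i : 0 <= b^T 0 i * b i 0 by rewrite mxE -expr2 sqr_ge0.
  rewrite lt_def sumr_ge0 ?andbT //; apply: contra_neq b0.
  move=> /eqP; rewrite psumr_eq0// => /allP b0.
  apply/matrixP => i j; rewrite mxE ord1.
  by have := b0 i (mem_index_enum _); rewrite mxE /= mulf_eq0 orbb => /eqP.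
move=> /andP[kr ur].
have extend w x : \sum_(j <- r) (if j == k then x else w j) *: a j =
    \sum_(j <- r) w j *: a j.
  rewrite big_seq [RHS]big_seq; apply: eq_bigr => j jr.
  by case: eqVneq => // jk; rewrite -jk jr in kr.
have [[w w0 bw]|[y ya yb]] := IH a b ur.
  left; exists (fun j => if j == k then 0 else w j) => [j|].
    by case: ifP.
  by rewrite big_cons eqxx scale0r add0r extend.
have [yk|yk] := leP 0 ((y *m a k) 0 0).
  by right; exists y => // j; rewrite inE => /orP[/eqP->|/ya].
have yk0 : (y *m a k) 0 0 != 0 by rewrite lt_eqF.
(* Project along [a k] onto the hyperplane orthogonal to [y]. *)
pose q (v : 'cV[F]_n) := (y *m v) 0 0 / (y *m a k) 0 0.
pose pr v := v - q v *: a k.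
have [[w w0 bw]|[z za zb]] := IH (pr \o a) (pr b) ur.
  (* The coefficient of [a k] restores what [pr] removed; it is nonnegative since [q b > 0] and
     [q (a i) <= 0] on the tail. *)
  left; exists (fun j => if j == k then q b - \sum_(i <- r) w i * q (a i)
                         else w j) => [j|].
    case: ifP => // _; rewrite subr_ge0 (@le_trans _ _ 0)//.
      rewrite big_seq sumr_le0// => i /ya yi.
      by rewrite mulr_ge0_le0// mulr_ge0_le0// invr_le0 ltW.
    by rewrite ltW// nmulr_rgt0// invr_lt0.
  rewrite big_cons eqxx extend scalerBl scaler_suml.
  rewrite -[LHS](subrK (q b *: a k)) -/(pr b) bw addrC -addrA; congr (_ + _).
  rewrite [RHS]addrC -sumrB; apply: eq_bigr => i _.
  by rewrite /pr /= scalerBr scalerA.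
(* [z'] is the row vector of [z] composed with [pr], so it vanishes on [a k]. *)
pose z' := z - ((z *m a k) 0 0 / (y *m a k) 0 0) *: y.
have z'E v : (z' *m v) 0 0 = (z *m pr v) 0 0.
  have eB (s t : 'M[F]_1) : (s - t) 0 0 = s 0 0 - t 0 0 by rewrite !mxE.
  have eZ c (s : 'M[F]_1) : (c *: s) 0 0 = c * s 0 0 by rewrite mxE.
  rewrite mulmxBl mulmxBr -scalemxAl -scalemxAr !eB !eZ; congr (_ - _).
  by rewrite mulrC mulrA mulrAC.
right; exists z' => [j|]; rewrite z'E// inE => /orP[/eqP->|/za//].
by rewrite /pr /q divff// scale1r subrr mulmx0 mxE.
Qed.

(** Each pair is a gap between consecutive values, with the upper end as threshold. Thresholds above
    [x0] make every term vanish at the smallest value. *)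
Lemma layer_cake (F : realFieldType) (s : seq F) (x0 : F) :
  path <%R x0 s ->
  exists2 p : seq (F * F), {in p, forall q, 0 < q.1 /\ x0 < q.2} &
    {in x0 :: s, forall y, y = x0 + \sum_(q <- p) q.1 * (q.2 <= y)%R%:R}.
Proof.
elim: s x0 => [|x1 s IH] x0 /=.
  move=> _; exists [::] => // y.
  by rewrite inE => /eqP->; rewrite big_nil addr0.
case/andP=> x01 xs; have [p p0 pE] := IH _ xs.
have p0' : {in (x1 - x0, x1) :: p, forall q, 0 < q.1 /\ x0 < q.2}.
  move=> q; rewrite inE => /orP[/eqP->|/p0[q1 q2]]; first by rewrite subr_gt0.
  by split=> //; exact: lt_trans q2.
exists ((x1 - x0, x1) :: p) => // y; rewrite inE => /orP[/eqP->|ys].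
  rewrite big_seq big1 ?addr0// => q /p0'[_ x0q].
  by rewrite leNgt x0q mulr0.
have x1y : x1 <= y.
  move: ys; rewrite inE => /orP[/eqP->//|ys].
  by have /allP/(_ y ys)/ltW := order_path_min lt_trans xs.
by rewrite big_cons /= x1y mulr1 addrA subrKC; exact: pE.
Qed.

Lemma layer_cake_fun (F : realFieldType) (I : finType) (c : I -> F) :
  exists x0, exists2 p : seq (F * F), {in p, forall q, 0 < q.1} &
    forall i, c i = x0 + \sum_(q <- p) q.1 * (q.2 <= c i)%R%:R.
Proof.
have : perm_eq (sort <=%R (undup (codom c))) (undup (codom c)).
  by rewrite perm_sort.
have := sort_lt_sorted (undup (codom c)); rewrite undup_uniq.
case: (sort _ _) => [|x0 s] /= xs /perm_mem cE.
  exists 0; exists [::] => // i.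
  by have := cE (c i); rewrite mem_undup codom_f.
have [p p0 pE] := layer_cake xs.
exists x0; exists p => [q /p0[]//|i].
by apply: pE; rewrite cE mem_undup codom_f.
Qed.

(** Summation by level sets; the zero total of [f] removes the base value [x0]. *)
Lemma sum_layer_cake (F : realFieldType) (I : finType) (c f : I -> F) x0
    (p : seq (F * F)) :
  (forall i, c i = x0 + \sum_(q <- p) q.1 * (q.2 <= c i)%R%:R) ->
  \sum_i f i = 0 ->
  \sum_i c i * f i = \sum_(q <- p) q.1 * \sum_(i | q.2 <= c i) f i.
Proof.
move=> cE f0; under eq_bigr do rewrite cE mulrDl mulr_suml.
rewrite big_split /= -mulr_sumr f0 mulr0 add0r exchange_big.
apply: eq_bigr => q _.
rewrite mulr_sumr [RHS]big_mkcond; apply: eq_bigr => i _ /=.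
by case: ifP; rewrite ?mulr1 ?mulr0 ?mul0r.
Qed.

(** * Bases drawn from a finite family of vectors *)

Section Matroid.
Context (K : fieldType) (V : vectType K) (I : finType) (v : I -> V).
Implicit Types (A B S : {set I}) (L : {vspace V}).

Definition vspan A : {vspace V} := <<[seq v i | i in A]>>%VS.

Definition vfree A := free [seq v i | i in A].

Definition vbasis_set B := basis_of fullv [seq v i | i in B].

Lemma mem_vspan A i : i \in A -> v i \in vspan A.
Proof. by move=> iA; apply: memv_span; apply: map_f; rewrite mem_enum. Qed.

Lemma vspan_subP A L :
  reflect {in A, forall i, v i \in L} (vspan A <= L)%VS.
Proof.
apply: (iffP span_subvP) => [h i iA|h _ /mapP[i iA ->]]; last first.
  by apply: h; rewrite mem_enum in iA.
by apply/h/map_f; rewrite mem_enum.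
Qed.

Lemma vspanS A B : A \subset B -> (vspan A <= vspan B)%VS.
Proof. by move=> /subsetP AB; apply/vspan_subP => i /AB/mem_vspan. Qed.

Lemma perm_image_setU A B : [disjoint A & B] ->
  perm_eq [seq v i | i in A :|: B] ([seq v i | i in A] ++ [seq v i | i in B]).
Proof.
move=> dAB; rewrite -map_cat; apply/perm_map/uniq_perm => [||i].
- exact: enum_uniq.
- rewrite cat_uniq !enum_uniq andbT /=; apply/hasPn => i.
  by rewrite !mem_enum => iB; rewrite (disjointFl dAB iB).
- by rewrite mem_cat !mem_enum inE.
Qed.

Lemma vfreeS A B : A \subset B -> vfree B -> vfree A.
Proof.
move=> AB; rewrite /vfree -(setID B A) (setIidPr AB).
rewrite (perm_free (perm_image_setU _)) => [/catl_free//|].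
by rewrite -setI_eq0 setIDA (setIidPl AB) setDv.
Qed.

Lemma vfree0 : vfree set0.
Proof. by rewrite /vfree /image_mem enum_set0 nil_free. Qed.

Lemma vfreeU1 A i : vfree A -> v i \notin vspan A -> vfree (i |: A).
Proof.
move=> fA iA; have iA' : i \notin A by apply: contra iA; exact: mem_vspan.
rewrite /vfree (perm_free (perm_image_setU _)) ?disjoints1//.
by rewrite /image_mem enum_set1 /= free_cons; apply/andP.
Qed.

Lemma vfree_dim A : vfree A -> \dim (vspan A) = #|A|.
Proof. by rewrite /vfree /free size_image => /eqP. Qed.

Lemma vfree_card_le B L : vfree B -> (#|B :&: [set i | v i \in L]| <= \dim L)%N.
Proof.
move=> fB; rewrite -(vfree_dim (vfreeS (subsetIl _ _) fB)).
by apply/dimvS/vspan_subP => i; rewrite !inE => /andP[].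
Qed.

Lemma vbasis_setE B : vbasis_set B = vfree B && (#|B| == \dim {:V})%N.
Proof.
rewrite /vbasis_set basisEfree size_image.
rewrite -/(vfree B) -/(vspan B) subvf /=; case: (boolP (vfree B)) => //= fB.
by rewrite eqn_leq -(vfree_dim fB) (dimvS (subvf (vspan B))).
Qed.

Lemma vspan_basis B : vbasis_set B -> vspan B = fullv.
Proof. exact: span_basis. Qed.

(** A free set of maximal cardinality between [A] and [S] works: a vector of [S] outside its span
    could be added. *)
Lemma exists_vbasis_between A S : A \subset S -> vfree A ->
  exists B, [/\ A \subset B, B \subset S, vfree B & vspan B = vspan S].
Proof.
move=> AS fA; pose P B := [&& A \subset B, B \subset S & vfree B].
have PA : P A by rewrite /P subxx AS.
case: (arg_maxnP (fun B => #|B|) PA) => B /and3P[AB BS fB] Bmax.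
exists B; split=> //; apply/eqP; rewrite eqEsubv vspanS//=.
apply/vspan_subP => i iS; apply: contraT => iB.
have : P (i |: B).
  rewrite /P vfreeU1// andbT subUset sub1set iS BS.
  by rewrite (subset_trans AB) ?subsetUr.
have iB' : i \notin B by apply: contra iB; exact: mem_vspan.
by move=> /Bmax; rewrite cardsU1 iB' /= add1n ltnn.
Qed.

(* Complementary subspaces [L], [L'] covering the vectors turn the two bounds of
   [vfree_card_le] into equalities. *)
Lemma split_basis_card B L L' : vbasis_set B -> complementary L L' ->
  (forall i, v i \in L \/ v i \in L') -> #|B :&: [set i | v i \in L]| = \dim L.
Proof.
rewrite vbasis_setE => /andP[fB /eqP cB] [LL0 LLf] cov.
apply/eqP; rewrite eqn_leq vfree_card_le//=.
have dLL : (\dim L + \dim L')%N = #|B|.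
  by rewrite -dimv_sum_cap LL0 LLf dimv0 addn0 cB.
rewrite -(leq_add2r (\dim L')) dLL -(cardsID [set i | v i \in L] B) leq_add2l.
apply: leq_trans (vfree_card_le L' fB); apply/subset_leq_card/subsetP => i.
by rewrite !inE => /andP[iL ->]; case: (cov i) => // /(negP iL).
Qed.

(** [L'] is spanned by the vectors outside [L]. A basis of [L'] chosen among them extends to a basis
    [B] of the whole space. As [B] has [\dim L] vectors in [L], the dimension of [L'] is at most the
    codimension of [L], and the sum is direct. *)
Lemma split_of_basis_card L : vspan setT = fullv ->
  (forall B, vbasis_set B -> #|B :&: [set i | v i \in L]| = \dim L) ->
  exists2 L', complementary L L' & forall i, v i \in L \/ v i \in L'.
Proof.
move=> vT cL; pose S := [set i | v i \notin L]; pose L' := vspan S.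
have cov i : v i \in L \/ v i \in L'.
  by have [iL|iL] := boolP (v i \in L); [left|right; rewrite mem_vspan ?inE].
exists L' => //; have LLf : (L + L')%VS = fullv.
  apply/eqP; rewrite eqEsubv subvf -vT; apply/vspan_subP => i _.
  by have [iL|iL] := cov i; [apply: subvP iL; exact: addvSl
                            |apply: subvP iL; exact: addvSr].
split=> //.
have [A [_ AS fA sA]] := exists_vbasis_between (sub0set S) vfree0.
have [B [AB _ fB sB]] := exists_vbasis_between (subsetT A) fA.
have bB : vbasis_set B by rewrite vbasis_setE fB -(vfree_dim fB) sB vT eqxx.
apply/eqP; rewrite -dimv_eq0 -leqn0 -(leq_add2l (\dim (L + L'))) addn0.
rewrite dimv_sum_cap LLf; move: bB (cL _ bB).
rewrite vbasis_setE => /andP[_ /eqP<-] <-.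
rewrite -(cardsID [set i | v i \in L] B) leq_add2l /L' -sA vfree_dim//.
apply/subset_leq_card/subsetP => i iA; rewrite inE (subsetP AB _ iA) andbT.
by have := subsetP AS _ iA; rewrite !inE.
Qed.

(** Exchange: if [i] in the level set [S] were outside the span of [B :&: S], then [i |: (B :&: S)]
    would extend inside [i |: B] to a basis that loses some [j] with [c j < t <= c i] and so
    outweighs [B]. *)
Lemma max_basis_level_span (R : realFieldType) (c : I -> R) B t :
  vbasis_set B ->
  (forall B', vbasis_set B' -> \sum_(i in B') c i <= \sum_(i in B) c i) ->
  vspan (B :&: [set i | t <= c i]) = vspan [set i | t <= c i].
Proof.
move=> bB Bmax; move: (bB); rewrite vbasis_setE => /andP[fB /eqP cB].
set S := [set i | t <= c i].
apply/eqP; rewrite eqEsubv vspanS ?subsetIr//=.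
apply/vspan_subP => i iS; apply: contraT => iBS.
have iB : i \notin B.
  by apply: contra iBS => iB; apply: mem_vspan; rewrite inE iB.
have fA := vfreeU1 (vfreeS (subsetIl _ _) fB) iBS.
have [B' [AB' B'B fB' sB']] := exists_vbasis_between
  (setUS [set i] (subsetIl B S)) fA.
have bB' : vbasis_set B'.
  rewrite vbasis_setE fB' -(vfree_dim fB') sB' /= eqn_leq.
  rewrite (dimvS (subvf _)) /= -{1}(vspan_basis bB).
  by apply: dimvS; apply: vspanS; exact: subsetUr.
have cB' : #|B'| = #|B|.
  by move: bB'; rewrite vbasis_setE cB => /andP[_ /eqP].
have /cards1P[j jE] : #|(i |: B) :\: B'| == 1%N.
  by rewrite cardsD (setIidPr B'B) cardsU1 iB cB' addnK.
have : j \in (i |: B) :\: B' by rewrite jE set11.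
rewrite in_setD => /andP[jB' jiB].
have : j \notin i |: (B :&: S) by apply: contra jB'; exact: (subsetP AB').
rewrite in_setU1 negb_or in_setI => /andP[ji].
have jB : j \in B by move: jiB; rewrite in_setU1 (negbTE ji).
rewrite jB inE -ltNge => ct.
have B'E : B' = (i |: B) :\ j.
  by rewrite -jE setDDr setDv set0U (setIidPr B'B).
have ti : t <= c i by move: iS; rewrite inE.
(* With [c j] added on both sides, the left sum runs over [i |: B], and maximality reads
   [c i <= c j]. *)
have := Bmax _ bB'; rewrite -(lerD2l (c j)) B'E -(big_setD1 j jiB) /=.
by rewrite (big_setU1 _ iB) lerD2r leNgt (lt_le_trans ct ti).
Qed.

Lemma sum_mem_card (R : pzRingType) (P : pred I) B :
  \sum_(i | P i) (i \in B)%:R = #|B :&: [set i | P i]|%:R :> R.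
Proof.
rewrite -sum1_card natr_sum big_mkcond [RHS]big_mkcond; apply: eq_bigr => i _.
by rewrite !inE; case: (P i); case: (i \in B).
Qed.

Lemma exists_vbasis : vspan setT = fullv -> exists B, vbasis_set B.
Proof.
move=> vT; have [B [_ _ fB sB]] := exists_vbasis_between (sub0set setT) vfree0.
by exists B; rewrite vbasis_setE fB -(vfree_dim fB) sB vT eqxx.
Qed.

(** Here [x] stands for [gamma] times the dimension. For a heaviest basis [B], the pairing of [c]
    with [x] minus the indicator of [B] is nonnegative by assumption, while each of its layers is
    nonpositive by concentration; hence every layer vanishes. *)
Lemma concentrated_weight_constant (R : realFieldType) (x c : I -> R) :
  vspan setT = fullv ->
  (forall i, 0 < x i) ->
  \sum_i x i = (\dim {:V})%:R ->
  (forall L, \sum_(i | v i \in L) x i <= (\dim L)%:R) ->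
  (forall L, \sum_(i | v i \in L) x i = (\dim L)%:R ->
    exists2 L', complementary L L' & forall i, v i \in L \/ v i \in L') ->
  (forall B, vbasis_set B -> \sum_(i in B) c i <= \sum_i c i * x i) ->
  forall B, vbasis_set B -> \sum_(i in B) c i = \sum_i c i * x i.
Proof.
move=> vT x0 xT xL xsplit cx.
have [B0 bB0] := exists_vbasis vT.
case: (arg_maxP (fun B => \sum_(i in B) c i) bB0) => B bB Bmax.
pose S t := [set i | t <= c i]; pose D t := vspan (S t).
have SD t i : t <= c i -> v i \in D t by move=> ti; rewrite mem_vspan ?inE.
have cardBS t : #|B :&: S t| = \dim (D t).
  rewrite /D -(max_basis_level_span t bB Bmax) vfree_dim//.
  by apply: vfreeS (subsetIl _ _) _; move: bB; rewrite vbasis_setE => /andP[].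
pose f A i := x i - (i \in A)%:R.
have f0 A : vbasis_set A -> \sum_i f A i = 0.
  rewrite vbasis_setE => /andP[_ /eqP cA]; rewrite sumrB xT sum_mem_card.
  suff -> : A :&: [set i | true] = A by rewrite cA subrr.
  by apply/setP => i; rewrite !inE andbT.
have cf A : \sum_i c i * f A i = \sum_i c i * x i - \sum_(i in A) c i.
  rewrite [X in _ - X]big_mkcond -sumrB; apply: eq_bigr => i _.
  by rewrite mulrBr; case: (i \in A); rewrite ?mulr1 ?mulr0.
have xS t : \sum_(i | t <= c i) x i <= \sum_(i | v i \in D t) x i.
  rewrite big_mkcond [leRHS]big_mkcond; apply: ler_sum => i _.
  case: ifP => [/SD->//|_]; case: ifP => // _; exact: ltW.
have fS t A : \sum_(i | t <= c i) f A i =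
    \sum_(i | t <= c i) x i - #|A :&: S t|%:R by rewrite sumrB sum_mem_card.
have fB t : \sum_(i | t <= c i) f B i <= 0.
  by rewrite fS subr_le0 cardBS (le_trans (xS t)).
have [c0 [p p0 cE]] := layer_cake_fun c.
have pB : {in p, forall q, \sum_(i | q.2 <= c i) f B i = 0}.
  have : \sum_(q <- p) q.1 * \sum_(i | q.2 <= c i) f B i == 0.
    rewrite -(sum_layer_cake cE (f0 _ bB)) eq_le cf subr_ge0 cx// andbT -cf.
    rewrite (sum_layer_cake cE (f0 _ bB)) big_seq sumr_le0// => q /p0 q0.
    by rewrite mulr_ge0_le0// ltW.
  rewrite big_seq -oppr_eq0 -sumrN psumr_eq0 => [/allP h q qp|q qp].
    have := h q qp; rewrite qp oppr_eq0 mulf_eq0 => /orP[/eqP q0|/eqP//].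
    by have := p0 q qp; rewrite q0 ltxx.
  by rewrite oppr_ge0 mulr_ge0_le0// ltW// p0.
(* The vanishing layers say that the mass of each level set is the dimension of its span. This no
   longer mentions [B], so it serves any basis [A]. *)
move=> A bA; apply/eqP; rewrite eq_sym -subr_eq0 -cf.
rewrite (sum_layer_cake cE (f0 _ bA)) big_seq big1// => q /pB.
rewrite !fS cardBS => /eqP; rewrite subr_eq0 => /eqP xSE.
have xDE : \sum_(i | v i \in D q.2) x i = (\dim (D q.2))%:R.
  by apply/eqP; rewrite eq_le xL -xSE xS.
(* An index of the span outside the level set would add a positive [x i] to a mass that already
   equals the dimension. *)
have SDE : S q.2 = [set i | v i \in D q.2].
  apply/setP => i; rewrite !inE; apply/idP/idP => [/SD//|iD].
  apply: contraT => iS; have : \sum_(j | v j \in D q.2) x j <=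
      \sum_(j | (v j \in D q.2) && (j != i)) x j.
    rewrite xDE -xSE big_mkcond [leRHS]big_mkcond; apply: ler_sum => j _.
    case: ifP => [jS|_]; last by case: ifP => // _; exact: ltW.
    by rewrite SD//=; case: eqVneq => // ji; rewrite -ji jS in iS.
  by rewrite (bigD1 i)//= gerDr leNgt x0.
have [L' LL' cov] := xsplit _ xDE.
by rewrite xSE SDE (split_basis_card bA LL' cov) subrr mulr0.
Qed.

End Matroid.

(** * Positive convex combinations and relative interiors *)

(** Farkas' lemma for [- \sum_j a j] and the generators [a j] and [- x]. A representation writes a
    multiple of [x] with coefficients [1 + w (Some j) > 0], and [h] identifies the multiple as their
    sum. A separating [y] makes [- y] admissible in [dual], so every [y *m a j] is zero, against
    strict separation. *)
Lemma strict_convex_combination (F : realFieldType) (n : nat) (J : finType)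
    (a : J -> 'cV[F]_n) (x : 'cV[F]_n) (h : 'rV[F]_n) :
  J -> (forall j, (h *m a j) 0 0 = 1) -> (h *m x) 0 0 = 1 ->
  (forall y : 'rV[F]_n, (forall j, (y *m a j) 0 0 <= (y *m x) 0 0) ->
    forall j, (y *m a j) 0 0 = (y *m x) 0 0) ->
  exists2 w : J -> F, (forall j, 0 < w j) /\ \sum_j w j = 1 &
    x = \sum_j w j *: a j.
Proof.
move=> j0 ha hx dual.
pose g (o : option J) := if o is Some j then a j else - x.
pose r := None :: [seq Some j | j <- index_enum J].
have ur : uniq r.
  rewrite /= map_inj_uniq ?index_enum_uniq ?andbT => [|i j []//].
  by apply/mapP => -[].
have rj j : Some j \in r by rewrite inE map_f ?mem_index_enum.
have [[w w0]|[y yg]] := farkas g (- \sum_j a j) ur.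
- rewrite big_cons big_map /= scalerN => wE.
  have {}wE : w None *: x = \sum_j (1 + w (Some j)) *: a j.
    under [RHS]eq_bigr do rewrite scalerDl scale1r.
    by rewrite big_split /= -[\sum_j a j]opprK wE opprD opprK subrK.
  have wN : w None = \sum_j (1 + w (Some j)).
    have := congr1 (fun z => (h *m z) 0 0) wE.
    rewrite -scalemxAr mxE hx mulr1 mulmx_sumr summxE => ->.
    by apply: eq_bigr => j _; rewrite -scalemxAr mxE ha mulr1.
  have w1 j : 0 < 1 + w (Some j) by rewrite ltr_pwDl.
  have wN0 : 0 < w None.
    by rewrite wN (bigD1 j0)//= ltr_pwDl// sumr_ge0// => j _; exact: ltW.
  exists (fun j => (w None)^-1 * (1 + w (Some j))).
    split=> [j|]; first by rewrite mulr_gt0// invr_gt0.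
    by rewrite -mulr_sumr -wN mulVf// gt_eqF.
  under eq_bigr do rewrite -scalerA.
  by rewrite -scaler_sumr -wE scalerK// gt_eqF.
- rewrite mulmxN mxE oppr_lt0 mulmx_sumr summxE.
  have ya j : 0 <= (y *m a j) 0 0 by exact: (yg (Some j) (rj j)).
  have yx : (y *m x) 0 0 <= 0.
    by have := yg None (mem_head _ _); rewrite /= mulmxN mxE oppr_ge0.
  have yax j : (y *m a j) 0 0 = (y *m x) 0 0.
    have eN (s : 'cV[F]_n) : (- y *m s) 0 0 = - (y *m s) 0 0.
      by rewrite mulNmx mxE.
    apply: oppr_inj; rewrite -!eN; apply: dual => i; rewrite !eN lerN2.
    exact: le_trans (ya i).
  rewrite big1 ?ltxx// => j _.
  by apply/eqP; rewrite eq_le ya andbT yax.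
Qed.

(** The new point is the affine combination of [x] and [p] with weights [1 + e] and [- e], so it
    stays in the affine hull; it tends to [x] as [e] tends to [0]. *)
Lemma relint_extend (R : realType) (m : nat) (A : set 'cV[R]_m)
    (x p : 'cV[R]_m) :
  relint A x -> A p -> exists2 e : R, 0 < e & A (x + e *: (x - p)).
Proof.
move=> Ax Ap; have Ax' : A x by exact: nbhs_subspace_singleton Ax.
have affx : affine_hull A x.
  exists 1%N, (fun=> 1), (fun=> x).
  by split=> //; rewrite big_ord1 ?scale1r.
have nA : \forall z \near x, affine_hull A z -> A z.
  suff : within (affine_hull A) (nbhs x) A by [].
  by rewrite (nbhs_subspace_in affx).
have cf : ((fun t : R => x + t *: (x - p)) t @[t --> 0^'+] --> x)%classic.
  rewrite -[X in (_ --> X)%classic]addr0 -(scale0r (x - p)).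
  apply: cvgD; first exact: cvg_cst.
  by apply: cvgZr_tmp; exact: cvg_at_right_filter.
near ((0 : R)^'+)%classic => e.
have e0 : 0 < e by near: e; exact: nbhs_right_gt.
exists e => //.
have : affine_hull A (x + e *: (x - p)) -> A (x + e *: (x - p)).
  by near: e; exact: cf nA.
apply; exists 2%N, (fun i => if i == 0 then 1 + e else - e),
  (fun i => if i == 0 then x else p).
split=> [|i|]; rewrite ?big_ord_recl ?big_ord0 /=.
- by rewrite addr0 addrK.
- by case: ifP.
- by rewrite addr0 scalerDl scale1r scalerBr scaleNr addrA.
Unshelve. all: by end_near. Qed.

(** Points of the affine hull get coefficients [w j + d z j] that depend continuously on [z] and
    equal [w j] at [x]; finitely many positive numbers stay nonnegative nearby. *)
Lemma relint_hull (R : realType) (m : nat) (A : set 'cV[R]_m) (J : finType)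
    (a : J -> 'cV[R]_m) (w : J -> R) :
  (forall q, A q <-> exists w' : J -> R,
    [/\ forall j, 0 <= w' j, \sum_j w' j = 1 & q = \sum_j w' j *: a j]) ->
  (forall j, 0 < w j) -> \sum_j w j = 1 ->
  relint A (\sum_j w j *: a j).
Proof.
move=> AP w0 w1; pose x : 'cV[R]_m := \sum_j w j *: a j; rewrite -/x.
have Ax : A x by apply/AP; exists w; split=> // j; exact: ltW.
have affx : affine_hull A x.
  exists 1%N, (fun=> 1), (fun=> x).
  by split=> //; rewrite big_ord1 ?scale1r.
suff : within (affine_hull A) (nbhs x) A by rewrite (nbhs_subspace_in affx).
(* Affine combinations become linear ones after appending a coordinate 1. *)
pose lift (q : 'cV[R]_m) : 'rV[R]_(m + 1) := row_mx q^T 1%:M.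
pose M := \matrix_(j < #|J|) lift (a (enum_val j)).
have lift_sum (I : finType) (v : I -> R) (q : I -> 'cV[R]_m) :
    \sum_i v i = 1 -> lift (\sum_i v i *: q i) = \sum_i v i *: lift (q i).
  move=> v1; rewrite -[RHS]hsubmxK !linear_sum /=; congr row_mx.
    by rewrite linear_sum; apply: eq_bigr => i _; rewrite !linearZ /= row_mxKl.
  under eq_bigr do rewrite linearZ /= row_mxKr.
  by rewrite -scaler_suml v1 scale1r.
have liftA q : A q -> (lift q <= M)%MS.
  move=> /AP[v [_ v1 ->]]; rewrite lift_sum// summx_sub// => j _.
  apply: scalemx_sub; have := row_sub (enum_rank j) M.
  by rewrite rowK enum_rankK.
(* The [a j] may be affinely dependent; [pinvmx] makes a linear choice of coefficients. The appended
   [0] forces them to sum to zero. *)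
pose d (z : 'cV[R]_m) j := (row_mx (z - x)^T 0 *m pinvmx M) 0 (enum_rank j).
have dE z : affine_hull A z ->
    z = \sum_j (w j + d z j) *: a j /\ \sum_j (w j + d z j) = 1.
  move=> [k [v [q [v1 Aq zE]]]].
  have : (row_mx (z - x)^T 0 <= M)%MS.
    have -> : row_mx (z - x)^T 0 = lift z - lift x.
      by rewrite /lift opp_row_mx add_row_mx subrr linearB.
    apply: addmx_sub; last by rewrite eqmx_opp liftA.
    rewrite zE lift_sum// summx_sub// => i _; apply: scalemx_sub; exact: liftA.
  move=> /mulmxKpV; rewrite mulmx_sum_row (reindex enum_rank) /=; last first.
    exact/onW_bij/enum_rank_bij.
  under eq_bigr do rewrite rowK enum_rankK -/(d z _).
  move=> dM; split.
    have := congr1 lsubmx dM; rewrite linear_sum /= row_mxKl => /(congr1 trmx).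
    rewrite trmxK linear_sum /= => zx; under eq_bigr do rewrite scalerDl.
    rewrite big_split /= -/x -[LHS](subrK x) addrC -zx; congr (_ + _).
    by apply: eq_bigr => j _; rewrite !linearZ /= row_mxKl trmxK.
  rewrite big_split /= w1; suff -> : \sum_j d z j = 0 by rewrite addr0.
  have := congr1 rsubmx dM; rewrite linear_sum /= row_mxKr => /matrixP/(_ 0 0).
  rewrite summxE [RHS]mxE => d0; apply: etrans d0; apply: eq_bigr => j _.
  by rewrite linearZ /= row_mxKr !mxE mulr1.
have : \forall z \near x, forall j, 0 <= w j + d z j.
  apply: (@filter_forall _ J (fun j z => is_true (0 <= w j + d z j)) (nbhs x)).
  move=> j.
  pose g (z : 'cV[R]_m) : R := w j +
    \sum_l (z l 0 - x l 0) * pinvmx M (lshift 1 l) (enum_rank j).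
  have gE z : w j + d z j = g z.
    congr (_ + _); rewrite /d mxE big_split_ord /=.
    rewrite [X in _ + X]big1 ?addr0 => [|l _].
      by apply: eq_bigr => l _; rewrite row_mxEl !mxE.
    by rewrite row_mxEr mxE mul0r.
  have gx : (g z @[z --> x] --> w j)%classic.
    have <- : g x = w j.
      by rewrite /g big1 ?addr0// => l _; rewrite subrr mul0r.
    apply: (@cvgD _ _ _ (nbhs x)); first exact: cvg_cst.
    apply: cvg_big => [|l _]; first exact: add_continuous.
    apply: cvgMr_tmp; apply: cvgB; last exact: cvg_cst.
    exact: coord_continuous.
  by apply: filterS (cvgr_gt _ gx _ (w0 j)) => z; rewrite gE => /ltW.
apply: filterS => z wd /dE[zE d1]; apply/AP.
by exists (fun j => w j + d z j).
Qed.

(** * Concentration inequalities on the polytope *)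

Section SubspaceConcentrationPolytope.
Context (R : realType) (n m : nat) (U : 'M[R]_(n.+1, m)).

Let u (i : 'I_m) : 'cV[R]_n.+1 := col i U.

Definition basis_sets : {set {set 'I_m}} := [set B | vbasis_set u B].

Definition basis_vertex (j : 'I_#|basis_sets|) : 'cV[R]_m :=
  n.+1%:R^-1 *: chi R (enum_val j).

Lemma basis_setP (j : 'I_#|basis_sets|) : vbasis_set u (enum_val j).
Proof. by have := enum_valP j; rewrite inE. Qed.

(** A convex combination may repeat vertices; grouping its terms by the basis that [supp] recovers
    leaves one weight per basis. *)
Lemma PsccP (x : 'cV[R]_m) : Pscc U x <->
  exists w : 'I_#|basis_sets| -> R,
    [/\ forall j, 0 <= w j, \sum_j w j = 1 &
        x = \sum_j w j *: basis_vertex j].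
Proof.
split=> [[_ [k [w [p [w0 w1 Ap ->]]]] <-]|[w [w0 w1 ->]]]; last first.
  exists (\sum_j w j *: chi R (enum_val j)).
    exists #|basis_sets|, w, (fun j => chi R (enum_val j)); split=> // j.
    by exists (enum_val j) => //; exact: basis_setP.
  rewrite scaler_sumr; apply: eq_bigr => j _.
  by rewrite /basis_vertex !scalerA mulrC.
pose supp (q : 'cV[R]_m) := [set i | q i 0 == 1].
have suppK B : supp (chi R B) = B.
  apply/setP => i; rewrite inE mxE.
  by case: (i \in B); rewrite ?eqxx// eq_sym oner_eq0.
have pE i : chi R (supp (p i)) = p i by have [B _ <-] := Ap i; rewrite suppK.
have pb i : true -> supp (p i) \in basis_sets.
  by have [B bB <-] := Ap i; rewrite suppK inE => _; exact: bB.
exists (fun j => \sum_(i | supp (p i) == enum_val j) w i); split=> [j||].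
- exact: sumr_ge0.
- rewrite -w1 [RHS](partition_big (fun i => supp (p i)) (mem basis_sets))//=.
  by rewrite [RHS]big_enum_val.
- rewrite (partition_big (fun i => supp (p i)) (mem basis_sets))//=.
  rewrite [X in _ *: X]big_enum_val /= scaler_sumr; apply: eq_bigr => j _.
  rewrite scalerA mulrC -scalerA scaler_suml; congr (_ *: _).
  by apply: eq_bigr => i /eqP <-; rewrite pE.
Qed.

Lemma basis_vertex_in_Pscc j : Pscc U (basis_vertex j).
Proof.
apply/PsccP; exists (fun k => (k == j)%:R); split=> [k||].
- exact: ler0n.
- by rewrite (bigD1 j)//= eqxx big1 ?addr0// => k /negbTE ->.
- rewrite (bigD1 j)//= eqxx scale1r big1 ?addr0// => k /negbTE ->.
  by rewrite scale0r.
Qed.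

Lemma sum_basis_vertex (P : pred 'I_m) j :
  \sum_(i | P i) basis_vertex j i 0 =
  n.+1%:R^-1 * #|enum_val j :&: [set i | P i]|%:R.
Proof.
by rewrite -sum_mem_card mulr_sumr; apply: eq_bigr => i _; rewrite !mxE.
Qed.

Lemma sum_convex_vertices (w : 'I_#|basis_sets| -> R) (P : pred 'I_m) :
  \sum_(i | P i) (\sum_j w j *: basis_vertex j) i 0 =
  \sum_j w j * (n.+1%:R^-1 * #|enum_val j :&: [set i | P i]|%:R).
Proof.
under eq_bigr do rewrite summxE; rewrite exchange_big; apply: eq_bigr => j _.
by rewrite -sum_basis_vertex mulr_sumr; apply: eq_bigr => i _; rewrite mxE.
Qed.

Lemma dim_cV : \dim {: 'cV[R]_n.+1} = n.+1.
Proof. by rewrite dimvf dim_matrix mulr1. Qed.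

(** By convexity a vertex suffices, and there a free set meets [L] in at most [\dim L] vectors. *)
Lemma Pscc_subspace_le (x : 'cV[R]_m) (L : {vspace 'cV[R]_n.+1}) :
  Pscc U x -> \sum_(i | u i \in L) x i 0 <= (\dim L)%:R / n.+1%:R.
Proof.
move=> /PsccP[w [w0 w1 ->]]; rewrite sum_convex_vertices.
have -> : (\dim L)%:R / n.+1%:R = \sum_j w j * ((\dim L)%:R / n.+1%:R) :> R.
  by rewrite -mulr_suml w1 mul1r.
apply: ler_sum => j _.
apply: ler_wpM2l => //; rewrite mulrC ler_pM2r ?invr_gt0// ler_nat.
by apply: vfree_card_le; have := basis_setP j; rewrite vbasis_setE => /andP[].
Qed.

Lemma Pscc_split_eq (x : 'cV[R]_m) (L L' : {vspace 'cV[R]_n.+1}) :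
  Pscc U x -> complementary L L' -> (forall i, u i \in L \/ u i \in L') ->
  \sum_(i | u i \in L) x i 0 = (\dim L)%:R / n.+1%:R.
Proof.
move=> /PsccP[w [w0 w1 ->]] LL' cov; rewrite sum_convex_vertices.
have -> : (\dim L)%:R / n.+1%:R = \sum_j w j * ((\dim L)%:R / n.+1%:R) :> R.
  by rewrite -mulr_suml w1 mul1r.
apply: eq_bigr => j _.
by rewrite (split_basis_card (basis_setP j) LL' cov) [_^-1 * _]mulrC.
Qed.

Lemma vspan_Ucal : Ucal U -> vspan u setT = fullv.
Proof.
move=> [_ _ posU]; apply/eqP; rewrite eqEsubv subvf; apply/subvP => x _.
have : pos_hull U x by rewrite posU.
by case=> c _ ->; apply: memv_suml => i _; rewrite memvZ// mem_vspan ?inE.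
Qed.

(** If a basis met [L] in fewer than [\dim L] vectors, moving from [gamma] away from its vertex
    would push the mass of [L] above the bound. *)
Lemma relint_concentrated (gamma : 'cV[R]_m) :
  vspan u setT = fullv -> relint (Pscc U) gamma ->
  forall L : {vspace 'cV[R]_n.+1},
    \sum_(i | u i \in L) gamma i 0 = (\dim L)%:R / n.+1%:R ->
  exists2 L' : {vspace 'cV[R]_n.+1}, complementary L L' &
      forall i, u i \in L \/ u i \in L'.
Proof.
move=> uT rg L gL; apply: split_of_basis_card => // B bB.
have bB' : B \in basis_sets by rewrite inE.
pose j := enum_rank_in bB' B; have jB : enum_val j = B by rewrite enum_rankK_in.
have [e e0] := relint_extend rg (basis_vertex_in_Pscc j).
move=> /(Pscc_subspace_le L).
have -> : \sum_(i | u i \in L) (gamma + e *: (gamma - basis_vertex j)) i 0 =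
    \sum_(i | u i \in L) gamma i 0 + e * (\sum_(i | u i \in L) gamma i 0 -
      \sum_(i | u i \in L) basis_vertex j i 0).
  rewrite -sumrB mulr_sumr -big_split; apply: eq_bigr => i _.
  by rewrite !mxE.
rewrite gL gerDl pmulr_rle0// subr_le0 sum_basis_vertex jB mulrC.
rewrite ler_pM2l ?invr_gt0// ler_nat => leL.
apply/eqP; rewrite eqn_leq leL andbT vfree_card_le//.
by move: bB; rewrite vbasis_setE => /andP[].
Qed.

Lemma concentrated_relint (gamma : 'cV[R]_m) :
  vspan u setT = fullv ->
  (forall i, 0 < gamma i 0) -> \sum_i gamma i 0 = 1 ->
  (forall L : {vspace 'cV[R]_n.+1},
    \sum_(i | u i \in L) gamma i 0 <= (\dim L)%:R / n.+1%:R) ->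
  (forall L : {vspace 'cV[R]_n.+1},
    \sum_(i | u i \in L) gamma i 0 = (\dim L)%:R / n.+1%:R ->
    exists2 L' : {vspace 'cV[R]_n.+1}, complementary L L' &
      forall i, u i \in L \/ u i \in L') ->
  relint (Pscc U) gamma.
Proof.
move=> uT g0 g1 gL gsplit.
have N0 : n.+1%:R != 0 :> R by rewrite pnatr_eq0.
have [B bB] := exists_vbasis uT.
have bB' : B \in basis_sets by rewrite inE.
have h1 (x : 'cV[R]_m) : (const_mx 1 *m x) 0 0 = \sum_i x i 0 :> R.
  by rewrite mxE; apply: eq_bigr => i _; rewrite mxE mul1r.
(* The all-ones row is the normalizing functional: a basis has [n.+1] elements, so the coordinates
   of each vertex sum to [1]. *)
have [||y ydual j|w [w0 w1] ->] :=
  @strict_convex_combination _ _ _ basis_vertex gamma (const_mx 1)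
    (enum_rank_in bB' B).
- move=> j; rewrite h1 sum_basis_vertex.
  have := basis_setP j; rewrite vbasis_setE dim_cV => /andP[_ /eqP cj].
  suff -> : enum_val j :&: [set i | true] = enum_val j by rewrite cj mulVf.
  by apply/setP => i; rewrite !inE andbT.
- by rewrite h1.
- pose c i := y 0 i; pose x i := n.+1%:R * gamma i 0.
  have cv k : (y *m basis_vertex k) 0 0 =
      n.+1%:R^-1 * \sum_(i in enum_val k) c i.
    rewrite mxE mulr_sumr [RHS]big_mkcond; apply: eq_bigr => i _.
    by rewrite !mxE; case: ifP => _; rewrite ?mulr0// mulr1 mulrC.
  have cx : \sum_i c i * x i = n.+1%:R * (y *m gamma) 0 0.
    by rewrite mxE mulr_sumr; apply: eq_bigr => i _; rewrite mulrCA.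
  have xL (L : {vspace 'cV[R]_n.+1}) : \sum_(i | u i \in L) x i =
    n.+1%:R * \sum_(i | u i \in L) gamma i 0 by rewrite mulr_sumr.
  suff cE : \sum_(i in enum_val j) c i = \sum_i c i * x i.
    by rewrite cv cE cx mulKf.
  apply: (concentrated_weight_constant uT) (basis_setP j) => [i||L|L|A bA].
  + by rewrite mulr_gt0.
  + by rewrite dim_cV -mulr_sumr g1 mulr1.
  + by rewrite xL mulrC -ler_pdivlMr.
  + by rewrite xL => xE; apply: gsplit; rewrite -xE mulrC mulKf.
  + have bA' : A \in basis_sets by rewrite inE.
    have := ydual (enum_rank_in bA' A); rewrite cv enum_rankK_in// cx.
    by rewrite ler_pdivrMl.
- by apply: relint_hull => // q; exact: PsccP.
Qed.

End SubspaceConcentrationPolytope.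

(** * From the measure to sums of weights *)

Lemma mu_sphere_sub (R : realType) (n m : nat) (U : 'M[R]_(n.+1, m))
    (hU : Ucal U) (gamma : 'cV[R]_m) (gamma_gt0 : forall i, 0 < gamma i 0)
    (L : {vspace 'cV[R]_n.+1}) :
  mu hU gamma_gt0 (sphere_sub L) = (\sum_(i | col i U \in L) gamma i 0)%:E.
Proof.
rewrite /mu /= /discrete_measure [in RHS]big_mkcond -sumEFin.
apply: eq_bigr => i _.
rewrite diracE -EFinM /=; congr (_%:E).
suff -> : (sphere_col hU i \in sphere_sub L) = (col i U \in L).
  by case: ifP; rewrite ?mulr1 ?mulr0.
by apply/idP/idP => [/set_mem//|h]; apply/mem_set.
Qed.

Lemma mu_setT (R : realType) (n m : nat) (U : 'M[R]_(n.+1, m))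
    (hU : Ucal U) (gamma : 'cV[R]_m) (gamma_gt0 : forall i, 0 < gamma i 0) :
  mu hU gamma_gt0 classical_sets.setT = (\sum_i gamma i 0)%:E.
Proof.
rewrite /mu /= /discrete_measure -sumEFin; apply: eq_bigr => i _.
by rewrite diracE mem_set// mule1.
Qed.

Theorem proposition1p1 (R : realType) (n m : nat) (U : 'M[R]_(n.+1, m))
    (hU : Ucal U) (gamma : 'cV[R]_m)
    (gamma_gt0 : forall i : 'I_m, 0 < gamma i 0)
    (gamma_sum : \sum_(i < m) gamma i 0 = 1) :
  subspace_concentration U (mu hU gamma_gt0) <-> relint (Pscc U) gamma.
Proof.
have uT := vspan_Ucal hU.
have le_muE (L : {vspace 'cV[R]_n.+1}) :
    (mu hU gamma_gt0 (sphere_sub L) <=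
      ((\dim L)%:R / n.+1%:R)%:E * mu hU gamma_gt0 classical_sets.setT)%E =
    (\sum_(i | col i U \in L) gamma i 0 <= (\dim L)%:R / n.+1%:R).
  by rewrite mu_sphere_sub mu_setT gamma_sum mule1 lee_fin.
have eq_muE (L : {vspace 'cV[R]_n.+1}) :
    (mu hU gamma_gt0 (sphere_sub L) =
      ((\dim L)%:R / n.+1%:R)%:E * mu hU gamma_gt0 classical_sets.setT)%E <->
    \sum_(i | col i U \in L) gamma i 0 = (\dim L)%:R / n.+1%:R.
  by rewrite mu_sphere_sub mu_setT gamma_sum mule1; split=> [[]|->].
rewrite /subspace_concentration; split=> [[le_mu eq_mu]|rg].
  (* The concentration condition covers proper subspaces only; the whole space has mass [1] and
     complement [0]. *)
  apply: concentrated_relint => // L; have [->|Lf] := eqVneq L fullv.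
  - under eq_bigl do rewrite memvf.
    by rewrite gamma_sum dim_cV divff ?pnatr_eq0.
  - by rewrite -le_muE le_mu.
  - move=> _; exists 0%VS; last by move=> i; left; rewrite memvf.
    by split; [rewrite capv0|rewrite addv0].
  - by move=> /eq_muE/(eq_mu L Lf).
have gP : Pscc U gamma by exact: nbhs_subspace_singleton rg.
split=> L Lf; first by rewrite le_muE Pscc_subspace_le.
split=> [/eq_muE|[L' LL' cov]]; first exact: relint_concentrated.
by apply/eq_muE; apply: Pscc_split_eq LL' cov.
Qed.
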